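(* Let $n\ge 2$. There exist an open set $\Omega\subset\mathbb{R}^n$, functions $\rho,\tau\in L^{q/2}(\Omega)$ for some $q>n$, and exponents $\alpha,\beta>0$ with $\alpha\beta=1$ such that for every $(\lambda,\mu)\in\mathbb{R}^2\setminus\{(0,0)\}$ there exists a weak subsolution $(u,v)\in(W^{1,2}(\Omega))^2$ of the system $$\begin{cases}-\Delta u=\lambda\rho(x)|v|^{\alpha-1}v&\text{in }\Omega,\\ -\Delta v=\mu\tau(x)|u|^{\beta-1}u&\text{in }\Omega,\end{cases}$$ for which at least one of the inequalities $$\sup_\Omega u\le\sup_{\partial\Omega}u^+,\qquad \sup_\Omega v\le\sup_{\partial\Omega}v^+$$ fails.
   Context: $w^+=\max\{w,0\}$. Weak subsolution: $(u,v)\in(W^{1,2}(\Omega))^2$ is a weak subsolution of the system if for all nonnegative $w_1,w_2\in C_0^1(\Omega)$, $$\int_\Omega Du\cdot Dw_1\,dx\le\int_\Omega\lambda\rho(x)|v|^{\alpha-1}v\,w_1\,dx,\qquad \int_\Omega Dv\cdot Dw_2\,dx\le\int_\Omega\mu\tau(x)|u|^{\beta-1}u\,w_2\,dx.$$ Suprema: $\sup_\Omega$ denotes the essential supremum, and for $w\in W^{1,2}(\Omega)$, $\sup_{\partial\Omega}w^+:=\inf\{k\ge0:(w-k)^+\in W_0^{1,2}(\Omega)\}$. *)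

(* Defs.v *)
From HB Require Import structures.
From mathcomp Require Import all_boot all_order all_algebra.
From mathcomp Require Import all_classical all_reals all_analysis.
From mathcomp Require Import ess_sup_inf.

Set Implicit Arguments.
Unset Strict Implicit.
Unset Printing Implicit Defensive.

Import Order.TTheory GRing.Theory Num.Theory.
Import numFieldNormedType.Exports.

Local Open Scope classical_set_scope.
Local Open Scope ring_scope.

(* Euclidean space is 'rV[R]_n with its library topology. It gets the product
   of n copies of the Borel sigma-algebra of R, which is the Borel
   sigma-algebra of 'rV[R]_n since R is second countable. *)

Section measurable_rV.
Context {R : realType} (n : nat).

Let coords : 'I_n -> 'rV[R]_n -> R := fun i x => x 0 i.

Let rV_set0 : g_sigma_preimage coords set0.
Proof. exact: sigma_algebra0. Qed.

Let rV_setC A : g_sigma_preimage coords A -> g_sigma_preimage coords (~` A).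
Proof. exact: sigma_algebraC. Qed.

Let rV_bigcup (F : (set 'rV[R]_n)^nat) :
  (forall i, g_sigma_preimage coords (F i)) ->
  g_sigma_preimage coords (\bigcup_i F i).
Proof. exact: sigma_algebra_bigcup. Qed.

HB.instance Definition _ := @isMeasurable.Build default_measure_display
  'rV[R]_n (g_sigma_preimage coords) rV_set0 rV_setC rV_bigcup.

Lemma measurable_coord (i : 'I_n) :
  measurable_fun [set: 'rV[R]_n] (fun x : 'rV[R]_n => x 0 i).
Proof.
move=> _ Y mY; rewrite setTI; apply: sub_sigma_algebra => /=.
rewrite -bigcup_seq/=; exists i => /=; first by rewrite mem_index_enum.
by exists Y => //; rewrite setTI.
Qed.

Lemma measurable_rVP d (T : measurableType d) (f : T -> 'rV[R]_n) :
  (forall i, measurable_fun [set: T] (fun t => f t 0 i)) ->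
  measurable_fun [set: T] f.
Proof.
move=> mf _ Y mY; rewrite setTI.
have : preimage_set_system setT f (g_sigma_preimage coords) (f @^-1` Y).
  by exists Y => //; rewrite setTI.
rewrite -g_sigma_preimageE; apply: smallest_sub.
  exact: sigma_algebra_measurable.
move=> B [C CB <-{B}].
move: CB; rewrite -bigcup_seq => -[i _ [A mA <-]]; rewrite !setTI.
by have := mf i measurableT A mA; rewrite setTI.
Qed.

End measurable_rV.

Section lebesgue_rV_step.
Context {R : realType} (n : nat).

Definition cons_rV (p : measurableTypeR R * 'rV[R]_n) : 'rV[R]_n.+1 :=
  row_mx (const_mx p.1 : 'rV_1) p.2.

Let uncons_rV (x : 'rV[R]_n.+1) : measurableTypeR R * 'rV[R]_n :=
  (x 0 ord0, \row_i x 0 (lift ord0 i)).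

Let cons_rV0 p : cons_rV p 0 ord0 = p.1.
Proof.
have -> : ord0 = lshift n ord0 :> 'I_(1 + n) by apply/val_inj.
by apply: etrans (row_mxEl _ _ _ _) _; rewrite mxE.
Qed.

Let cons_rVS p i : cons_rV p 0 (lift ord0 i) = p.2 0 i.
Proof.
have -> : lift ord0 i = rshift 1 i :> 'I_(1 + n) by apply/val_inj.
exact: row_mxEr.
Qed.

Let cons_rVK : cancel cons_rV uncons_rV.
Proof.
move=> [a x]; rewrite /uncons_rV cons_rV0; congr pair.
by apply/rowP => i; rewrite mxE cons_rVS.
Qed.

Lemma measurable_cons_rV : measurable_fun setT cons_rV.
Proof.
apply: measurable_rVP => i; case: (unliftP ord0 i) => [j ->|->].
  rewrite (_ : (fun t => _) = (fun x : 'rV[R]_n => x 0 j) \o snd); last first.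
    by apply/funext => p; rewrite cons_rVS.
  by apply: measurableT_comp => //; exact: measurable_coord.
rewrite (_ : (fun t => _) = fst); first exact: measurable_fst.
by apply/funext => p; rewrite cons_rV0.
Qed.

Let measurable_uncons_rV : measurable_fun setT uncons_rV.
Proof.
apply: measurable_fun_pair; first exact: measurable_coord.
apply: measurable_rVP => i.
by under eq_fun do rewrite mxE; exact: measurable_coord.
Qed.

Variable m : {sigma_finite_measure set 'rV[R]_n -> \bar R}.

Definition lebesgue_rV_step : set 'rV[R]_n.+1 -> \bar R :=
  pushforward (@lebesgue_measure R \x m)%E cons_rV.

HB.instance Definition _ := Measure.copy lebesgue_rV_step
  (measure_function_pushforward__canonical__measure_function_Measure
     (@lebesgue_measure R \x m)%E measurable_cons_rV).

Let lebesgue_rV_step_sigma_finite : sigma_finite setT lebesgue_rV_step.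
Proof.
have /sigma_finiteP[F [FT ndF Foo]] := sigma_finiteT (@lebesgue_measure R).
have /sigma_finiteP[G [GT ndG Goo]] := sigma_finiteT m.
exists (fun k => uncons_rV @^-1` (F k `*` G k)).
  rewrite -preimage_bigcup -[LHS](preimage_setT uncons_rV); congr (_ @^-1` _).
  rewrite -setXTT FT GT; apply/seteqP; split => [[x y] [/= [k _ Fx] [l _ Gy]]|].
    exists (maxn k l) => //; split => /=.
    - by move: x Fx; exact/subsetPset/ndF/leq_maxl.
    - by move: y Gy; exact/subsetPset/ndG/leq_maxr.
  by move=> [x y] [k _ [/= Fx Gy]]; split; exists k.
move=> k; have [mF Fkoo] := Foo k; have [mG Gkoo] := Goo k.
have mFG : measurable (F k `*` G k) by exact: measurableX.
split; first by rewrite -[X in measurable X]setTI; exact: measurable_uncons_rV.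
rewrite /lebesgue_rV_step /pushforward.
rewrite (_ : _ @^-1` _ = F k `*` G k); last first.
  by rewrite -comp_preimage (_ : _ \o _ = id) ?preimage_id//; apply/funext.
by rewrite product_measure1E// lte_mul_pinfty// ge0_fin_numE.
Qed.

HB.instance Definition _ := Measure_isSigmaFinite.Build _ _ _
  lebesgue_rV_step lebesgue_rV_step_sigma_finite.

End lebesgue_rV_step.

(* Lebesgue measure on R^n, as the n-fold product of that of R. *)
Fixpoint lebesgue_rV {R : realType} (n : nat) :
    {sigma_finite_measure set 'rV[R]_n -> \bar R} :=
  match n with
  | 0 => \d_(0 : 'rV[R]_0)
  | n'.+1 => lebesgue_rV_step (lebesgue_rV n')
  end.

Section function_spaces.
Context {R : realType} {n : nat}.
Implicit Types (Omega : set 'rV[R]_n) (f g w phi : 'rV[R]_n -> R).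

Definition dot (a b : 'rV[R]_n) : R := \sum_(i < n) a 0 i * b 0 i.

Definition grad f (x : 'rV[R]_n) : 'rV[R]_n :=
  \row_(i < n) 'D_('e_i : 'rV[R]_n) f x.

(* C_0^1(Omega): the C^1 functions with compact support contained in Omega;
   for Omega open they are identified with their extension by zero. *)
Definition C01 Omega : set ('rV[R]_n -> R) :=
  [set w | [/\ forall x, differentiable w x,
               continuous (grad w),
               compact (closure [set x | w x != 0]) &
               closure [set x | w x != 0] `<=` Omega]].

(* Functions on Omega are represented by total functions; only their values on
   Omega matter. [f \_ Omega] is the extension by zero. *)
Definition Lp Omega (p : R) : set ('rV[R]_n -> R) :=
  [set f | f \_ Omega \in Lfun (@lebesgue_rV R n) p%:E].

(* An element of W^{1,2}(Omega): a representative together with a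
   representative of its weak gradient, which is unique almost everywhere. *)
Record W12 Omega := MkW12 {
  W12_fun :> 'rV[R]_n -> R ;
  wgrad : 'rV[R]_n -> 'rV[R]_n ;
  W12_L2 : Lp Omega 2 W12_fun ;
  wgrad_L2 : forall i, Lp Omega 2 (fun x => wgrad x 0 i) ;
  wgradP : forall phi, C01 Omega phi -> forall i,
    \int[lebesgue_rV n]_(x in Omega) (W12_fun x * grad phi x 0 i) =
    - \int[lebesgue_rV n]_(x in Omega) (wgrad x 0 i * phi x)
}.

(* W_0^{1,2}(Omega): the closure of C_0^1(Omega) in W^{1,2}(Omega); the
   integral below is the square of the W^{1,2}(Omega)-norm of U - phi. *)
Definition W012 Omega : set ('rV[R]_n -> R) :=
  [set f | exists U : W12 Omega,
    {ae @lebesgue_rV R n, forall x, Omega x -> U x = f x} /\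
    forall eps : R, 0 < eps -> exists2 phi, C01 Omega phi &
      (\int[@lebesgue_rV R n]_(x in Omega)
         ((U x - phi x) ^+ 2 +
          dot (wgrad U x - grad phi x) (wgrad U x - grad phi x))%:E
       < eps%:E)%E].

(* The value -oo outside Omega does not contribute to the supremum. *)
Definition ess_sup_on Omega f : \bar R :=
  ess_sup (@lebesgue_rV R n) (patch (fun=> -oo%E) Omega (EFin \o f)).

(* sup over the boundary of w^+; the infimum of the empty set is +oo. *)
Definition bdry_sup_pos Omega w : \bar R :=
  ereal_inf [set k%:E | k in
    [set k : R | 0 <= k /\ W012 Omega (fun x => Num.max (w x - k) 0)]].

(* [s |-> |s|^(gamma - 1) s]; at s = 0 the value is 0, also for gamma < 1. *)
Definition signed_pow (gamma s : R) : R := `|s| `^ (gamma - 1) * s.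

(* The weak form of [- Delta u <= h]; the right-hand side is required to be
   meaningful for every test function. *)
Definition weak_le Omega (u : W12 Omega) (h : 'rV[R]_n -> R) : Prop :=
  forall w, C01 Omega w -> (forall x, 0 <= w x) ->
    (@lebesgue_rV R n).-integrable Omega (fun x => (h x * w x)%:E) /\
    \int[lebesgue_rV n]_(x in Omega) dot (wgrad u x) (grad w x) <=
    \int[lebesgue_rV n]_(x in Omega) (h x * w x).

Definition weak_subsolution Omega (lambda mu alpha beta : R)
    (rho tau : 'rV[R]_n -> R) (u v : W12 Omega) : Prop :=
  weak_le u (fun x => lambda * rho x * signed_pow alpha (v x)) /\
  weak_le v (fun x => mu * tau x * signed_pow beta (u x)).

End function_spaces.

(* Main.v *)
Require Import Defs.
From mathcomp Require Import all_boot all_order all_algebra.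
From mathcomp Require Import all_classical all_reals all_analysis.
From mathcomp Require Import ess_sup_inf measurable_realfun ring lra.

(** Taking [alpha = beta = 1], the maximum principle is defeated by weights
    with disjoint supports: [rho] and [tau] are the indicators of two disjoint
    open Euclidean unit balls [A] and [B] inside a cube [Omega].

    Suppose [lambda <> 0]. Let [u] be the bump [max(0, 1 - |x - a|^2)^3], where
    [a] is the centre of [A], and let [v] be the constant [K / lambda], where
    [K] bounds the Laplacian of [u]. In the first equation the right-hand side
    is [K] on [A], which dominates [- Delta u], and both sides vanish off [A].
    In the second equation the left-hand side vanishes because [v] is
    constant, and the right-hand side vanishes because [tau] vanishes on the
    support of [u], whatever [mu] is. But [u] is a nonzero
    nonnegative function of class C^1 with compact support in [Omega], so its
    boundary supremum is [0] while its essential supremum is positive. If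
    [lambda = 0] then [mu <> 0], and exchanging the roles of [u] and [v], and
    of [A] and [B], gives the same conclusion for [v].
    [bump_const_subsolution] is the common core of the two cases.

    Beyond the explicit derivatives of the bump, this needs the integration by
    parts formula [integration_by_parts_rV] for the iterated product measure.
    It reduces to [integral_partial_eq0]: a partial derivative of a C^1
    function with compact support has integral zero, which holds on the line by
    the fundamental theorem of calculus and in higher dimension by Fubini. The
    cube of the positive part makes the bump of class C^2, so that the formula
    applies also to its first derivatives. *)

Import Order.TTheory GRing.Theory Num.Theory.
Import numFieldNormedType.Exports.

Set Implicit Arguments.
Unset Strict Implicit.
Unset Printing Implicit Defensive.

Local Open Scope classical_set_scope.
Local Open Scope ring_scope.

(** * Borel sets of row vectors *)

Section measurability.
Context {R : realType} {n : nat}.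
Implicit Types (a x : 'rV[R]_n) (f : 'rV[R]_n -> R).

Lemma ball_rVP a r x :
  ball a r x <-> 0 < r /\ forall i, `|a 0 i - x 0 i| < r.
Proof.
split => [[r0 h]|[r0 h]]; split => //; first by move=> i; exact: h.
by move=> i j; rewrite (ord1 i); exact: h.
Qed.

Lemma ball0_rVP r x : ball (0 : 'rV[R]_n) r x <-> `|x| < r.
Proof. by rewrite -ball_normE /ball_/= sub0r normrN. Qed.

Lemma measurable_ball_rV a r : measurable (ball a r).
Proof.
have [r0|r0] := ltP 0 r; last first.
  rewrite (_ : ball a r = set0)//; apply/seteqP; split => // x /ball_rVP[r1 _].
  by move: (lt_le_trans r1 r0); rewrite ltxx.
have -> : ball a r =
    \big[setI/setT]_(i < n) ((fun x => x 0 i) @^-1` ball (a 0 i) r).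
  rewrite -bigcap_seq; apply/seteqP; split => x.
    by move=> /ball_rVP[_ h] i _; exact: h.
  move=> h; apply/ball_rVP; split => // i.
  by apply: h => /=; rewrite mem_index_enum.
apply: bigsetI_measurable => i _; rewrite -[X in measurable X]setTI.
by apply: measurable_coord => //; exact: (open_measurable (ball_open _ _)).
Qed.

(** An open set is the union of the balls with rational centre and rational
    radius that it contains, and there are countably many of these. *)
Lemma open_measurable_rV (U : set 'rV[R]_n) : open U -> measurable U.
Proof.
move=> oU.
pose B (p : 'rV[rat]_n * rat) : set 'rV[R]_n :=
  [set x | ball (map_mx ratr p.1 : 'rV[R]_n) (ratr p.2) `<=` U /\
           ball (map_mx ratr p.1 : 'rV[R]_n) (ratr p.2) x].
have -> : U = \bigcup_p B p.
  apply/seteqP; split => [x Ux|x [p _ [h1 h2]]]; last exact: h1.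
  have /nbhs_ballP[e /= e0 he] : nbhs x U by apply: open_nbhs_nbhs.
  have [q] := rat_in_itvoo e0; rewrite in_itv/= => /andP[q0 qe].
  have q20 : 0 < ratr (q / 2) :> R by rewrite ltr0q divr_gt0// -(ltr0q R).
  have hz i : exists z : rat, `|ratr z - x 0 i| < ratr (q / 2).
    have [|z] := @rat_in_itvoo R (x 0 i - ratr (q / 2)) (x 0 i + ratr (q / 2)).
      by lra.
    by rewrite in_itv/= => h; exists z; rewrite ltr_distl.
  pose z := (\row_i projT1 (cid (hz i)))%R.
  have zx i : `|ratr (z 0 i) - x 0 i| < ratr (q / 2).
    by rewrite mxE; case: cid.
  have xz : ball (map_mx ratr z : 'rV[R]_n) (ratr (q / 2)) x.
    by apply/ball_rVP; split => // i; rewrite mxE; exact: zx.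
  exists (z, q / 2) => //; split => //= y zy; apply: he.
  apply: (@le_ball _ _ _ (ratr (q / 2) + ratr (q / 2))).
    by rewrite -rmorphD/= -splitr ltW.
  by apply: ball_triangle zy; exact: ball_sym.
apply: countable_bigcupT_measurable => // p.
have [h|h] := pselect (ball (map_mx ratr p.1 : 'rV[R]_n) (ratr p.2) `<=` U).
  rewrite (_ : B p = ball (map_mx ratr p.1 : 'rV[R]_n) (ratr p.2)).
    exact: measurable_ball_rV.
  by apply/seteqP; split => [x []|x ].
by rewrite (_ : B p = set0)//; apply/seteqP; split => [x []|].
Qed.

Lemma continuous_measurable_rV f : continuous f -> measurable_fun setT f.
Proof.
move=> cf; apply: (measurability _ (RGenOInfty.measurableE R)) => //.
move=> /= _ [_ [x ->] <-]; rewrite setTI; apply: open_measurable_rV.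
by move/continuousP: cf; apply; exact: rray_open.
Qed.

End measurability.

(** * The iterated Lebesgue measure *)

Section integration.
Context {R : realType}.

Lemma bounded_support_integrable d (T : measurableType d)
    (mu : {measure set T -> \bar R}) (D : set T) (f : T -> R) (K : R) :
  measurable D -> (mu D < +oo)%E -> measurable_fun setT f ->
  (forall x, `|f x| <= K) -> (forall x, ~ D x -> f x = 0) ->
  mu.-integrable setT (EFin \o f).
Proof.
move=> mD Doo mf fK f0.
have -> : EFin \o f = (EFin \o f) \_ D.
  apply/funext => x; rewrite patchE; case: ifPn => // /negP xD /=.
  by rewrite f0// => Dx; apply: xD; rewrite inE.
rewrite -(integrable_mkcond _ mD); apply: measurable_bounded_integrable => //.
  exact: measurable_funTS.
exists K; split; first exact: num_real.
by move=> y Ky x _ /=; apply: le_trans (fK x) (ltW Ky).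
Qed.

Lemma cons_rV_ord0 n (p : measurableTypeR R * 'rV[R]_n) :
  cons_rV p 0 ord0 = p.1.
Proof.
have -> : ord0 = lshift n ord0 :> 'I_(1 + n) by apply/val_inj.
by apply: etrans (row_mxEl _ _ _ _) _; rewrite mxE.
Qed.

Lemma cons_rV_lift n (p : measurableTypeR R * 'rV[R]_n) i :
  cons_rV p 0 (lift ord0 i) = p.2 0 i.
Proof.
have -> : lift ord0 i = rshift 1 i :> 'I_(1 + n) by apply/val_inj.
exact: row_mxEr.
Qed.

(** In the sup norm a ball is a cube, hence a product of intervals. *)
Lemma lebesgue_rV_ball n (a : 'rV[R]_n) (r : R) : 0 < r ->
  lebesgue_rV n (ball a r) = ((2 * r) ^+ n)%:E.
Proof.
move=> r0; elim: n => [|n IH] in a *.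
  by rewrite /= diracE mem_set//; apply/ball_rVP; split => // -[].
rewrite /= /lebesgue_rV_step /pushforward.
have -> : @cons_rV R n @^-1` ball a r =
    ball (a 0 ord0) r `*` ball (\row_i a 0 (lift ord0 i)) r.
  apply/seteqP; split => [[t x] /= /ball_rVP[_ h]|
                          [t x] [/= h1 /ball_rVP[_ h2]]].
    split; first by have := h ord0; rewrite cons_rV_ord0.
    apply/ball_rVP; split => // i.
    by have := h (lift ord0 i); rewrite cons_rV_lift mxE.
  apply/ball_rVP; split => // i; case: (unliftP ord0 i) => [j ->|->].
    by have := h2 j; rewrite cons_rV_lift mxE.
  by rewrite cons_rV_ord0; exact: h1.
rewrite product_measure1E//; last exact: measurable_ball_rV.
  rewrite IH exprS EFinM -[(2 * r)%:E]/((2%:R * r)%:E) mulr_natl.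
  congr (_ * _)%E.
  by apply: lebesgue_measure_ball; exact: ltW.
exact: (open_measurable (ball_open _ _)).
Qed.

Lemma lebesgue_rV_ball_lty n (a : 'rV[R]_n) (r : R) : 0 < r ->
  (lebesgue_rV n (ball a r) < +oo)%E.
Proof. by move=> r0; rewrite lebesgue_rV_ball// ltry. Qed.

(** Fubini for one step of the iterated measure, with the first coordinate
    split off: it is integrated last in the first formula and first in the
    second one. *)
Lemma lebesgue_rVS_fubini n (f : 'rV[R]_n.+1 -> R) (K M : R) : 0 < M ->
  measurable_fun setT f ->
  (forall x, `|f x| <= K) -> (forall x, ~ ball 0 M x -> f x = 0) ->
  (\int[lebesgue_rV n.+1]_x (f x)%:E =
    \int[lebesgue_measure]_t \int[lebesgue_rV n]_x (f (cons_rV (t, x)))%:E)%E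
  /\ (\int[lebesgue_rV n.+1]_x (f x)%:E =
    \int[lebesgue_rV n]_x \int[lebesgue_measure]_t (f (cons_rV (t, x)))%:E)%E.
Proof.
move=> M0 mf fK f0.
have ifc : (@lebesgue_measure R \x lebesgue_rV n)%E.-integrable setT
    ((EFin \o f) \o @cons_rV R n).
  apply: (@bounded_support_integrable _ _ _ (@cons_rV R n @^-1` ball 0 M)
    (f \o @cons_rV R n) K).
  - rewrite -[X in measurable X]setTI; apply: measurable_cons_rV => //.
    exact: measurable_ball_rV.
  - apply: (@le_lt_trans _ _ ((2 * M) ^+ n.+1)%:E); last by rewrite ltry.
    by rewrite -(@lebesgue_rV_ball n.+1 0 M M0).
  - by apply: measurableT_comp => //; exact: measurable_cons_rV.
  - by move=> x; exact: fK.
  - by move=> x; exact: f0.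
have -> : (\int[lebesgue_rV n.+1]_x (f x)%:E =
    \int[(@lebesgue_measure R \x lebesgue_rV n)%E]_z (f (cons_rV z))%:E)%E.
  apply: (integral_pushforward (@measurable_cons_rV R n) _ ifc) => //.
  exact/measurable_EFinP.
by split; [rewrite -(fubini1 ifc)|rewrite -(fubini2 ifc)].
Qed.

End integration.

(** * Integrals of partial derivatives *)

Section integral_of_partial.
Context {R : realType}.

Lemma cons_rV_shift n (t : measurableTypeR R) (x : 'rV[R]_n) i h :
  cons_rV (t, h *: 'e_i + x) = h *: 'e_(lift ord0 i) + cons_rV (t, x).
Proof.
apply/rowP => j; rewrite [RHS]mxE [X in _ = X + _]mxE [X in _ = _ * X + _]mxE.
case: (unliftP ord0 j) => [k ->|->].
  by rewrite !cons_rV_lift/= !mxE eqxx/= (inj_eq lift_inj).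
by rewrite !cons_rV_ord0/= mulr0 add0r.
Qed.

Lemma cons_rV_shift0 n (t : R) (x : 'rV[R]_n) h :
  cons_rV (h *: 1 + t : measurableTypeR R, x) =
    h *: 'e_ord0 + cons_rV (t : measurableTypeR R, x).
Proof.
apply/rowP => j; rewrite [RHS]mxE [X in _ = X + _]mxE [X in _ = _ * X + _]mxE.
case: (unliftP ord0 j) => [k ->|->].
  by rewrite !cons_rV_lift/= mulr0 add0r.
by rewrite !cons_rV_ord0.
Qed.

Lemma cons_rV_continuousr n (t : measurableTypeR R) :
  continuous (fun x : 'rV[R]_n => cons_rV (t, x)).
Proof.
move=> x; apply/(@cvg_ballP _ _ _ (nbhs x)) => e e0.
apply/nbhs_ballP; exists e => //= y /ball_rVP[_ xy].
apply/ball_rVP; split => // j; case: (unliftP ord0 j) => [k ->|->].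
  by rewrite !cons_rV_lift; exact: xy.
by rewrite !cons_rV_ord0/= subrr normr0.
Qed.

Lemma cons_rV_continuousl n (x : 'rV[R]_n) :
  continuous (fun t : R => cons_rV (t : measurableTypeR R, x)).
Proof.
move=> t; apply/(@cvg_ballP _ _ _ (nbhs t)) => e e0.
apply/nbhs_ballP; exists e => //= s ts.
apply/ball_rVP; split => // j; case: (unliftP ord0 j) => [k ->|->].
  by rewrite !cons_rV_lift/= subrr normr0.
by rewrite !cons_rV_ord0/=; exact: ts.
Qed.

Lemma integral_derive_eq0 (g : R -> R) (M : R) : 0 < M ->
  (forall t, derivable g t 1) -> continuous ('D_1 g) ->
  (forall t, M <= `|t| -> g t = 0 /\ 'D_1 g t = 0) ->
  (\int[lebesgue_measure]_t ('D_1 g t)%:E = 0)%E.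
Proof.
move=> M0 dg cg g0.
have -> : (\int[lebesgue_measure]_t ('D_1 g t)%:E =
    \int[lebesgue_measure]_(t in `[(- M)%R, M]) ('D_1 g t)%:E)%E.
  rewrite [RHS]integral_mkcond; apply: eq_integral => t _.
  rewrite patchE; case: ifPn => //; rewrite notin_setE/= in_itv/= => h.
  congr EFin; apply: (g0 _ _).2; rewrite leNgt ltr_norml.
  by apply/negP => /andP[h1 h2]; apply: h; rewrite !ltW.
have cg' : continuous g.
  by move=> t; apply/differentiable_continuous/derivable1_diffP.
have [gM _] : g M = 0 /\ 'D_1 g M = 0 by apply: g0; rewrite ler_norm.
have [gNM _] : g (- M) = 0 /\ 'D_1 g (- M) = 0.
  by apply: g0; rewrite normrN ler_norm.
have -> : (0 = (g M)%:E - (g (- M))%:E :> \bar R)%E by rewrite gM gNM subee.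
apply: continuous_FTC2.
- by rewrite gtrN.
- exact: continuous_subspaceT.
- split => [t _| |]; first exact: dg.
    exact/cvg_at_right_filter/cg'.
  exact/cvg_at_left_filter/cg'.
- by move=> t _; rewrite derive1E.
Qed.

(** By induction on the dimension. For the first coordinate, integrate it first
    and apply [integral_derive_eq0] on each line; for any other coordinate,
    integrate the first one last and apply the induction hypothesis on each
    slice. The bounds are stated pointwise on the whole space so that slices
    inherit them. *)
Lemma integral_partial_eq0 n (g : 'rV[R]_n -> R) (i : 'I_n) (K M : R) : 0 < M ->
  (forall x, derivable g x 'e_i) -> continuous ('D_'e_i g) ->
  (forall x, `|'D_'e_i g x| <= K) ->
  (forall x, ~ ball 0 M x -> g x = 0 /\ 'D_'e_i g x = 0) ->
  (\int[lebesgue_rV n]_x ('D_'e_i g x)%:E = 0)%E.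
Proof.
move=> M0; elim: n => [|n IH] in g i *; first by case: i.
move=> dg cg gK g0.
have mD := continuous_measurable_rV cg.
have [E1 E2] := lebesgue_rVS_fubini M0 mD gK (fun x h => (g0 x h).2).
case: (unliftP ord0 i) => [j ij|i0].
- rewrite E1 integral0_eq// => t _.
  pose gt x := g (cons_rV (t, x)).
  (* equal difference quotients have equal limits *)
  have quot x : (fun h => h^-1 *: ((gt \o shift x) (h *: 'e_j) - gt x)) =
    (fun h => h^-1 *: ((g \o shift (cons_rV (t, x))) (h *: 'e_i) -
                        g (cons_rV (t, x)))).
    by apply/funext => h /=; rewrite /gt cons_rV_shift ij.
  have Dgt x : 'D_'e_j gt x = 'D_'e_i g (cons_rV (t, x)).
    by rewrite /derive quot.
  have <- : (\int[lebesgue_rV n]_x ('D_'e_j gt x)%:E = 0)%E.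
    apply: (IH gt j).
    + by move=> x; rewrite /derivable quot; exact: dg.
    + rewrite (_ : 'D_'e_j gt = 'D_'e_i g \o (fun x => cons_rV (t, x))).
        move=> x; apply: continuous_comp; last exact: cg.
        exact: cons_rV_continuousr.
      by apply/funext => x; rewrite Dgt.
    + by move=> x; rewrite Dgt; exact: gK.
    + move=> x xM; rewrite Dgt; apply: g0 => /ball_rVP[_ h].
      apply: xM; apply/ball_rVP; split => // k.
      by have := h (lift ord0 k); rewrite cons_rV_lift !mxE.
  by apply: eq_integral => x _; rewrite Dgt.
- rewrite E2 integral0_eq// => x _.
  pose gx (t : R) := g (cons_rV (t : measurableTypeR R, x)).
  have quot t : (fun h => h^-1 *: ((gx \o shift t) (h *: 1) - gx t)) =
    (fun h => h^-1 *: ((g \o shift (cons_rV (t : measurableTypeR R, x)))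
        (h *: 'e_i) - g (cons_rV (t : measurableTypeR R, x)))).
    by apply/funext => h /=; rewrite /gx cons_rV_shift0 i0.
  have Dgx t : 'D_1 gx t = 'D_'e_i g (cons_rV (t : measurableTypeR R, x)).
    by rewrite /derive quot.
  have <- : (\int[lebesgue_measure]_t ('D_1 gx t)%:E = 0)%E.
    apply: (integral_derive_eq0 M0).
    + by move=> t; rewrite /derivable quot; exact: dg.
    + rewrite (_ : 'D_1 gx =
          'D_'e_i g \o (fun t => cons_rV (t : measurableTypeR R, x))).
        move=> t; apply: continuous_comp; last exact: cg.
        exact: cons_rV_continuousl.
      by apply/funext => t; rewrite Dgx.
    + move=> t tM; rewrite Dgx; apply: g0 => /ball_rVP[_ /(_ ord0)].
      by rewrite cons_rV_ord0 mxE sub0r normrN/= ltNge tM.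
  by apply: eq_integral => t _; rewrite Dgx.
Qed.

End integral_of_partial.

(** * Test functions and integration by parts *)

Section test_functions.
Context {R : realType} {n : nat}.
Implicit Types (f w F : 'rV[R]_n -> R) (Omega : set 'rV[R]_n).

(** Closed balls are compact in finite dimension. *)
Lemma continuous_bounded_ball f (M : R) : continuous f ->
  exists K, forall x, `|x| <= M -> `|f x| <= K.
Proof.
move=> cf; pose A := [set x : 'rV[R]_n | `|x| <= M].
have cA : compact A.
  apply: bounded_closed_compact.
    exists M; split; first exact: num_real.
    by move=> y My x /= xM; apply: le_trans xM (ltW My).
  rewrite (_ : A = (@Num.norm _ _) @^-1` [set y | y <= M])//.
  apply: closed_comp; last exact: closed_le.
  by move=> x _; exact: norm_continuous.
have /compact_bounded[K [_ hK]] : compact (f @` A).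
  by apply: continuous_compact => //; exact: continuous_subspaceT.
exists (K + 1) => x xM; apply: hK; first by rewrite ltrDl.
by exists x.
Qed.

Lemma continuous_support_integrable f (M : R) : 0 < M -> continuous f ->
  (forall x, ~ ball 0 M x -> f x = 0) ->
  (exists K, forall x, `|f x| <= K) /\
  (@lebesgue_rV R n).-integrable setT (EFin \o f).
Proof.
move=> M0 cf f0; have [K fK] := continuous_bounded_ball M cf.
have fK' x : `|f x| <= K.
  have [xM|xM] := pselect (ball 0 M x).
    by apply: fK; move/ball0_rVP: xM; exact: ltW.
  rewrite f0// normr0; apply: le_trans (normr_ge0 (f 0)) (fK 0 _).
  by rewrite normr0 ltW.
split; first by exists K.
apply: (bounded_support_integrable (measurable_ball_rV 0 M) _ _ fK' f0).
  exact: lebesgue_rV_ball_lty.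
exact: continuous_measurable_rV.
Qed.

Lemma derive_notin_support w x v :
  ~ closure [set y | w y != 0] x -> w x = 0 /\ 'D_v w x = 0.
Proof.
move=> xw; have nw : \near x, w x = cst 0 x.
  have oC : open (~` closure [set y | w y != 0]).
    exact/closed_openC/closed_closure.
  have : \forall y \near x, (~` closure [set y | w y != 0]) y.
    exact: (open_nbhs_nbhs (conj oC xw)).
  apply: filterS => y hy; apply: contrapT => wy; apply: hy.
  by apply: subset_closure => /=; apply/eqP.
split; first exact: (nbhs_singleton nw).
by rewrite (near_eq_derive _ nw) derive_cst.
Qed.

Lemma C01_support Omega w : C01 Omega w ->
  exists2 M, 0 < M &
    forall x, ~ ball 0 M x -> forall v, w x = 0 /\ 'D_v w x = 0.
Proof.
move=> [_ _ /compact_bounded[M [_ hM]] _].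
exists (`|M| + 2) => [|x xM v]; first by rewrite ltr_wpDl.
apply: derive_notin_support => /(hM (`|M| + 1)) h; apply: xM.
apply/ball0_rVP; rewrite (@le_lt_trans _ _ (`|M| + 1))//.
  by apply: h; rewrite (le_lt_trans (ler_norm _))// ltrDl.
by rewrite ltrD2l ltr1n.
Qed.

Lemma C01_continuous Omega w : C01 Omega w -> continuous w.
Proof. by move=> [dw _ _ _] x; exact: differentiable_continuous. Qed.

Lemma C01_derivable Omega w x v : C01 Omega w -> derivable w x v.
Proof. by move=> [dw _ _ _]; exact: diff_derivable. Qed.

Lemma gradE w x i : grad w x 0 i = 'D_'e_i w x.
Proof. by rewrite mxE. Qed.

Lemma grad_continuous w i : continuous (grad w) -> continuous ('D_'e_i w).
Proof.
move=> cw; have -> : 'D_'e_i w = (fun A : 'rV[R]_n => A 0 i) \o grad w.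
  by apply/funext => x /=; rewrite gradE.
by move=> x; apply: continuous_comp; [exact: cw|exact: coord_continuous].
Qed.

Lemma C01_outside Omega w x v : C01 Omega w -> ~ Omega x ->
  w x = 0 /\ 'D_v w x = 0.
Proof.
by move=> [_ _ _ wO] xO; apply: derive_notin_support => /wO.
Qed.

Lemma Rintegral_outside Omega f : (forall x, ~ Omega x -> f x = 0) ->
  \int[lebesgue_rV n]_(x in Omega) f x = \int[lebesgue_rV n]_x f x.
Proof.
move=> f0; rewrite Rintegral_mkcond; congr Rintegral; apply/funext => x.
by rewrite patchE; case: ifPn => //; rewrite notin_setE => /f0 ->.
Qed.

(** The product [F * phi] is of class C^1 in direction [i], with compact support
    in [Omega], so its partial derivative has integral zero. *)
Lemma integration_by_parts_rV Omega F phi i :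
  (forall x, derivable F x 'e_i) -> continuous F -> continuous ('D_'e_i F) ->
  C01 Omega phi ->
  \int[lebesgue_rV n]_(x in Omega) (F x * 'D_'e_i phi x) =
  - \int[lebesgue_rV n]_(x in Omega) ('D_'e_i F x * phi x).
Proof.
move=> dF cF cDF Cphi; have [_ cgphi _ _] := Cphi.
have cphi := C01_continuous Cphi.
have cDphi := @grad_continuous phi i cgphi.
have [M M0 phi0] := C01_support Cphi.
have D0 x v : ~ Omega x -> phi x = 0 /\ 'D_v phi x = 0.
  exact: C01_outside Cphi.
rewrite (@Rintegral_outside Omega (fun x => F x * 'D_'e_i phi x)); last first.
  by move=> x /(D0 x 'e_i)[_ ->]; rewrite mulr0.
rewrite (@Rintegral_outside Omega (fun x => 'D_'e_i F x * phi x)); last first.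
  by move=> x /(D0 x 'e_i)[-> _]; rewrite mulr0.
have dFphi x : derivable (F * phi) x 'e_i.
  by apply: derivableM => //; exact: C01_derivable Cphi.
have DE x : 'D_'e_i (F * phi) x = F x * 'D_'e_i phi x + 'D_'e_i F x * phi x.
  rewrite deriveM//; last exact: C01_derivable Cphi.
  by congr (_ + _); rewrite mulrC.
have c1 : continuous (fun x => F x * 'D_'e_i phi x).
  by move=> x; exact: (continuousM (cF x) (cDphi x)).
have c2 : continuous (fun x => 'D_'e_i F x * phi x).
  by move=> x; exact: (continuousM (cDF x) (cphi x)).
have z1 x : ~ ball 0 M x -> F x * 'D_'e_i phi x = 0.
  by move=> /phi0/(_ 'e_i)[_ ->]; rewrite mulr0.
have z2 x : ~ ball 0 M x -> 'D_'e_i F x * phi x = 0.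
  by move=> /phi0/(_ 'e_i)[-> _]; rewrite mulr0.
have [_ i1] := continuous_support_integrable M0 c1 z1.
have [_ i2] := continuous_support_integrable M0 c2 z2.
apply/eqP; rewrite -addr_eq0 -RintegralD//.
have c3 : continuous ('D_'e_i (F * phi)).
  have -> : 'D_'e_i (F * phi) =
      (fun x => F x * 'D_'e_i phi x + 'D_'e_i F x * phi x).
    by apply/funext => x; rewrite DE.
  by move=> x; exact: (continuousD (c1 x) (c2 x)).
have z3 x : ~ ball 0 M x -> (F * phi) x = 0 /\ 'D_'e_i (F * phi) x = 0.
  move=> /phi0/(_ 'e_i)[h1 h2]; rewrite DE h2 h1 !mulr0 addr0; split => //.
  by rewrite fctE/= h1 mulr0.
have [[K hK] _] :=
  continuous_support_integrable M0 c3 (fun x h => (z3 x h).2).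
have := integral_partial_eq0 M0 dFphi c3 hK z3.
by under eq_integral do rewrite DE; rewrite /Rintegral => ->.
Qed.

Lemma Lp_bounded Omega f (p K : R) : 1 <= p -> measurable Omega ->
  (lebesgue_rV n Omega < +oo)%E -> measurable_fun setT f ->
  (forall x, Omega x -> `|f x| <= K) -> Lp Omega p f.
Proof.
move=> p1 mO Ooo mf fK; have p0 : 0 < p by apply: lt_le_trans p1.
have mfO : measurable_fun setT (f \_ Omega).
  by apply/(measurable_restrictT _ mO); exact: measurable_funTS.
rewrite /Lp/= inE/=; apply/andP; split; rewrite inE//=.
rewrite /finite_norm unlock/= poweR_lty//.
pose h x := `|(f \_ Omega) x| `^ p.
have -> : (fun x => `|(EFin \o (f \_ Omega)) x| `^ p)%E = EFin \o h.
  by apply/funext => x.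
apply: integrable_lty => //.
apply: (bounded_support_integrable (K := `|K| `^ p) mO) => //.
- by apply: (measurableT_comp (measurable_powR _)); exact: measurableT_comp.
- move=> x; rewrite /h ger0_norm ?powR_ge0// ge0_ler_powR ?nnegrE ?(ltW p0)//.
  rewrite patchE; case: ifPn => [|_]; last by rewrite normr0.
  by rewrite inE => xO; exact: le_trans (fK x xO) (ler_norm K).
- by move=> x xO; rewrite /h patchE memNset// normr0 powR0// gt_eqF.
Qed.

Lemma Lp_ball f (p M : R) : 1 <= p -> 0 < M -> continuous f ->
  Lp (ball 0 M) p f.
Proof.
move=> p1 M0 cf; have [K fK] := continuous_bounded_ball M cf.
apply: (@Lp_bounded _ _ _ K) => //.
- exact: measurable_ball_rV.
- exact: lebesgue_rV_ball_lty.
- exact: continuous_measurable_rV.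
- by move=> x /ball0_rVP/ltW; exact: fK.
Qed.

(** Integration by parts says that the classical gradient is a weak one; on a
    ball, continuity up to the closure makes everything square integrable. *)
Lemma C1_W12 F (M : R) : 0 < M -> (forall x, differentiable F x) ->
  continuous (grad F) ->
  exists U : W12 (ball 0 M), W12_fun U = F /\ wgrad U = grad F.
Proof.
move=> M0 dF cgF.
have cF : continuous F by move=> x; exact: differentiable_continuous.
have cD i : continuous (fun x => grad F x 0 i).
  rewrite (_ : (fun x => _) = 'D_'e_i F); first exact: grad_continuous.
  by apply/funext => x; rewrite gradE.
have h1 : Lp (ball 0 M) 2 F by apply: Lp_ball => //; rewrite ler1n.
have h2 i : Lp (ball 0 M) 2 (fun x => grad F x 0 i).
  by apply: Lp_ball => //; rewrite ler1n.
have h3 phi : C01 (ball 0 M) phi -> forall i,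
    \int[lebesgue_rV n]_(x in ball 0 M) (F x * grad phi x 0 i) =
    - \int[lebesgue_rV n]_(x in ball 0 M) (grad F x 0 i * phi x).
  move=> Cphi i.
  under eq_Rintegral do rewrite gradE.
  under [in RHS]eq_Rintegral do rewrite gradE.
  apply: integration_by_parts_rV => //; last exact: grad_continuous.
  by move=> x; exact: diff_derivable.
by exists (MkW12 h1 h2 h3).
Qed.

End test_functions.

(** * The bump function *)

Section bump.
Context {R : realType}.

Definition pos_pow (k : nat) (t : R) : R := Num.max 0 t ^+ k.

Lemma pos_pow_gt0 k t : 0 < t -> pos_pow k t = t ^+ k.
Proof. by move=> t0; rewrite /pos_pow max_r// ltW. Qed.

Lemma pos_pow_le0 k t : t <= 0 -> pos_pow k.+1 t = 0.
Proof. by move=> t0; rewrite /pos_pow max_l// expr0n. Qed.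

Lemma pos_pow_continuous k : continuous (pos_pow k).
Proof.
move=> t.
apply: (@continuous_comp _ _ _ (fun s : R => Num.max 0 s) (fun s => s ^+ k)).
  by apply: continuous_max; [exact: cst_continuous|exact: cvg_id].
exact: exprn_continuous.
Qed.

(** At the origin the difference quotient of [max(0, t)^(k + 2)] is
    [max(0, t)^(k + 1)], which tends to zero. *)
Lemma is_derive_pos_pow (k : nat) (t : R) :
  is_derive t (1 : R) (pos_pow k.+2) (k.+2%:R * pos_pow k.+1 t).
Proof.
have [t0|t0|->] := ltgtP t 0.
- rewrite pos_pow_le0 ?ltW// mulr0.
  apply: (@near_eq_is_derive _ _ _ (cst 0)).
  near=> s; rewrite pos_pow_le0//; near: s; exact: lt_le_nbhsl.
- apply: (@near_eq_is_derive _ _ _ (@GRing.exp R ^~ k.+2)).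
    near=> s; rewrite pos_pow_gt0//; near: s; exact: lt_nbhsr.
  rewrite pos_pow_gt0//.
  have -> : @GRing.exp R ^~ k.+2 = (id : R -> R) ^+ k.+2.
    by apply/funext => s; rewrite exprfctE.
  by apply: is_derive_eq; rewrite /GRing.scale/= mulr1.
- rewrite pos_pow_le0// mulr0.
  have cvg0 : (fun h => h^-1 *: ((pos_pow k.+2 \o shift 0) (h *: 1) -
      pos_pow k.+2 0)) @ 0^' --> (0 : R).
    have h1 : pos_pow k.+1 @ 0^' --> (0 : R).
      have := @pos_pow_continuous k.+1 0; rewrite /continuous_at pos_pow_le0//.
      exact: cvg_within_filter.
    apply: cvg_trans h1; apply: near_eq_cvg; near=> h.
    have h0 : h != 0 by near: h; exact: nbhs_dnbhs_neq.
    rewrite (pos_pow_le0 _ (lexx 0)) subr0 /= addr0 /GRing.scale/= mulr1.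
    have [hp|hn] := ltP 0 h; last by rewrite !pos_pow_le0// mulr0.
    by rewrite !pos_pow_gt0// [in RHS]exprS mulKf.
  by apply: DeriveDef; [apply/cvg_ex; exists 0|exact: cvg_lim cvg0].
Unshelve. all: by end_near. Qed.

Lemma derive_comp_real (V : normedModType R) (q : V -> R) (P : R -> R) x v :
  differentiable q x -> derivable P (q x) 1 ->
  'D_v (P \o q) x = 'D_1 P (q x) * 'D_v q x.
Proof.
move=> dq /derivable1_diffP dP.
rewrite !deriveE//; last exact: differentiable_comp.
rewrite diff_comp//= -[in LHS](mulr1 ('d q x v)) -/(_ *: 1) linearZ.
by rewrite mulrC.
Qed.

Context {n : nat}.
Implicit Types (a x : 'rV[R]_n).

(** This is positive exactly on the open Euclidean unit ball centred at [a]. *)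
Definition cap a x : R := 1 - dot (x - a) (x - a).

Lemma is_derive_coord x i c :
  is_derive x 'e_i (fun y : 'rV[R]_n => y 0 i - c) 1.
Proof.
have cvg1 : (fun h => h^-1 *: (((fun y : 'rV[R]_n => y 0 i - c) \o shift x)
    (h *: 'e_i) - (x 0 i - c))) @ 0^' --> (1 : R).
  have h1 : (fun=> 1 : R) @ (0 : R)^' --> (1 : R) by exact: cvg_cst.
  apply: cvg_trans h1; apply: near_eq_cvg; near=> h.
  have h0 : h != 0 by near: h; exact: nbhs_dnbhs_neq.
  by rewrite /= !mxE !eqxx /GRing.scale/=; field.
by apply: DeriveDef; [apply/cvg_ex; exists 1|exact: cvg_lim cvg1].
Unshelve. all: by end_near. Qed.

Lemma is_derive_cap a x i : is_derive x 'e_i (cap a) (- 2 * (x 0 i - a 0 i)).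
Proof.
have dotE h : dot (h *: 'e_i + x - a) (h *: 'e_i + x - a) =
    dot (x - a) (x - a) + h * (2 * (x 0 i - a 0 i) + h).
  rewrite /dot (bigD1 i)//= [in RHS](bigD1 i)//= !mxE !eqxx /=.
  rewrite (eq_bigr (fun j => (x - a) 0 j * (x - a) 0 j)); last first.
    by move=> j ji; rewrite !mxE (negbTE ji) mulr0 add0r.
  ring.
have cvg1 : (fun h => h^-1 *: ((cap a \o shift x) (h *: 'e_i) - cap a x))
    @ 0^' --> - 2 * (x 0 i - a 0 i).
  have h1 : (fun h : R => - 2 * (x 0 i - a 0 i) - h) @ 0^' -->
      - 2 * (x 0 i - a 0 i).
    rewrite -[X in _ --> X]subr0; apply: cvgB; first exact: cvg_cst.
    exact: cvg_within_filter.
  apply: cvg_trans h1; apply: near_eq_cvg; near=> h.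
  have h0 : h != 0 by near: h; exact: nbhs_dnbhs_neq.
  by rewrite /= /cap dotE /GRing.scale/=; field.
by apply: DeriveDef; [apply/cvg_ex; eexists; exact: cvg1|exact: cvg_lim cvg1].
Unshelve. all: by end_near. Qed.

Lemma differentiable_coordB x i c :
  differentiable (fun y : 'rV[R]_n => y 0 i - c) x.
Proof. by apply: differentiableB => //; exact: differentiable_coord. Qed.

Lemma differentiable_cap a x : differentiable (cap a) x.
Proof.
have -> : cap a = cst 1 - \sum_(i < n)
    ((fun y : 'rV[R]_n => y 0 i - a 0 i) * (fun y => y 0 i - a 0 i)).
  apply/funext => y; rewrite /cap /dot fctE/=; congr (_ - _).
  rewrite fct_sumE; apply: eq_bigr => i _.
  by rewrite !mxE.
apply: differentiableB => //; apply: differentiable_sum => i.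
by apply: differentiableM; exact: differentiable_coordB.
Qed.

(** The third power is the least integer power for which the bump is of
    class C^2. *)
Definition bump a x : R := pos_pow 3 (cap a x).

Definition bump_grad a i x : R :=
  - 6 * ((x 0 i - a 0 i) * pos_pow 2 (cap a x)).

(** The second partial derivative of [bump a] in direction [i]; these add up
    to its Laplacian. *)
Definition bump_hess a i x : R :=
  - 6 * (pos_pow 2 (cap a x) -
         4 * ((x 0 i - a 0 i) ^+ 2 * pos_pow 1 (cap a x))).

Lemma derivable_pos_pow k t : derivable (pos_pow k.+2) t 1.
Proof. by have := is_derive_pos_pow k t => -[]. Qed.

Lemma differentiable_pos_pow_cap k a x :
  differentiable (pos_pow k.+2 \o cap a) x.
Proof.
apply: differentiable_comp; first exact: differentiable_cap.
exact/derivable1_diffP/derivable_pos_pow.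
Qed.

Lemma derive_pos_pow_cap k a x i : 'D_'e_i (pos_pow k.+2 \o cap a) x =
  - 2 * k.+2%:R * ((x 0 i - a 0 i) * pos_pow k.+1 (cap a x)).
Proof.
rewrite derive_comp_real; [|exact: differentiable_cap|exact: derivable_pos_pow].
rewrite (@derive_val _ _ _ _ _ _ _ (is_derive_pos_pow _ _)).
by rewrite (@derive_val _ _ _ _ _ _ _ (is_derive_cap _ _ _)); ring.
Qed.

Lemma differentiable_bump a x : differentiable (bump a) x.
Proof. exact: differentiable_pos_pow_cap. Qed.

Lemma derive_bump a x i : 'D_'e_i (bump a) x = bump_grad a i x.
Proof. by rewrite (derive_pos_pow_cap 1)/bump_grad; ring. Qed.

Lemma differentiable_bump_grad a i x : differentiable (bump_grad a i) x.
Proof.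
have -> : bump_grad a i =
    (-6) *: ((fun y : 'rV[R]_n => y 0 i - a 0 i) * (pos_pow 2 \o cap a)).
  by apply/funext => y.
apply: differentiableZ; apply: differentiableM.
  exact: differentiable_coordB.
exact: differentiable_pos_pow_cap.
Qed.

Lemma derive_scaled_prod (f g : 'rV[R]_n -> R) (c : R) x v :
  derivable f x v -> derivable g x v ->
  'D_v (c *: (f * g)) x = c * (f x * 'D_v g x + g x * 'D_v f x).
Proof.
by move=> df dg; rewrite (deriveZ c (derivableM df dg)) (deriveM df dg).
Qed.

Lemma derive_bump_grad a i x : 'D_'e_i (bump_grad a i) x = bump_hess a i x.
Proof.
have -> : bump_grad a i =
    (-6) *: ((fun y : 'rV[R]_n => y 0 i - a 0 i) * (pos_pow 2 \o cap a)).
  by apply/funext => y.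
have d1 : derivable (fun y : 'rV[R]_n => y 0 i - a 0 i) x 'e_i.
  exact/diff_derivable/differentiable_coordB.
have d2 : derivable (pos_pow 2 \o cap a) x 'e_i.
  exact/diff_derivable/differentiable_pos_pow_cap.
rewrite derive_scaled_prod// (derive_pos_pow_cap 0) /bump_hess.
rewrite (@derive_val _ _ _ _ _ _ _ (is_derive_coord _ _ _)).
by rewrite [(_ \o _) x]/=; ring.
Qed.

Lemma continuous_cap a : continuous (cap a).
Proof. by move=> x; exact/differentiable_continuous/differentiable_cap. Qed.

Lemma continuous_pos_pow_cap k a : continuous (fun x => pos_pow k (cap a x)).
Proof.
move=> x; apply: (@continuous_comp _ _ _ (cap a) (pos_pow k)).
  exact: continuous_cap.
exact: pos_pow_continuous.
Qed.

Lemma continuous_bump_hess a i : continuous (bump_hess a i).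
Proof.
have c1 : continuous (fun x : 'rV[R]_n => (x 0 i - a 0 i) ^+ 2).
  move=> x; apply: (@continuous_comp _ _ _
    (fun y : 'rV[R]_n => y 0 i - a 0 i) (fun s => s ^+ 2)).
    exact/differentiable_continuous/differentiable_coordB.
  exact: exprn_continuous.
have cc (c : R) : continuous (fun _ : 'rV[R]_n => c) by exact: cst_continuous.
have c2 := @continuous_pos_pow_cap 1 a.
have c3 := @continuous_pos_pow_cap 2 a.
move=> x; apply: (continuousM (cc (-6) x)).
exact: (continuousB (c3 x)
  (continuousM (cc 4 x) (continuousM (c1 x) (c2 x)))).
Qed.

Lemma bump_hess_outside a i x : cap a x <= 0 -> bump_hess a i x = 0.
Proof. by move=> h; rewrite /bump_hess !pos_pow_le0// !mulr0 subr0 mulr0. Qed.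

Lemma continuous_grad (F : 'rV[R]_n -> R) :
  (forall i, continuous ('D_'e_i F)) -> continuous (grad F).
Proof.
move=> cF x; apply/(@cvg_ballP _ _ _ (nbhs x)) => e e0.
have : nbhs x [set y | forall i, ball ('D_'e_i F x) e ('D_'e_i F y)].
  apply: (@filter_forall _ _
    (fun i => [set y | ball ('D_'e_i F x) e ('D_'e_i F y)]) (nbhs x)) => i.
  by have /(@cvg_ballP _ _ _ (nbhs x)) := cF i x; apply.
apply: filterS => y h; apply/ball_rVP; split => // i.
by rewrite !gradE; exact: h.
Qed.

Lemma continuous_grad_bump a : continuous (grad (bump a)).
Proof.
apply: continuous_grad => i.
rewrite (_ : 'D_'e_i (bump a) = bump_grad a i).
  by move=> x; exact/differentiable_continuous/differentiable_bump_grad.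
by apply/funext => x; rewrite derive_bump.
Qed.

Lemma cap_ge0_coord a x i : 0 <= cap a x -> `|x 0 i - a 0 i| <= 1.
Proof.
rewrite /cap subr_ge0 /dot (bigD1 i)//= !mxE => h.
have s0 : 0 <= \sum_(j < n | j != i) (x - a) 0 j * (x - a) 0 j.
  by apply: sumr_ge0 => j _; rewrite -expr2 sqr_ge0.
by rewrite ler_norml; nra.
Qed.

Lemma bump_C01 a (M : R) : 0 < M -> (forall i, `|a 0 i| + 1 < M) ->
  C01 (ball 0 M) (bump a).
Proof.
move=> M0 aM.
have sub : closure [set x | bump a x != 0] `<=` [set x | 0 <= cap a x].
  (* a closed set containing the points where the bump is nonzero *)
  have cl : closed [set x | 0 <= cap a x].
    rewrite (_ : [set x | _] = cap a @^-1` [set y | 0 <= y])//.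
    by apply: closed_comp; [move=> x _; exact: continuous_cap|exact: closed_ge].
  rewrite ((closure_id _).1 cl); apply: closure_subset => x /=.
  by apply: contraNT; rewrite -ltNge /bump => /ltW/(pos_pow_le0 2) ->.
have subM : closure [set x | bump a x != 0] `<=` ball 0 M.
  move=> x /sub xa; apply/ball_rVP; split => // i.
  rewrite mxE sub0r normrN -(subrK (a 0 i) (x 0 i)).
  apply: le_lt_trans (ler_normD _ _) _; apply: le_lt_trans (aM i).
  by rewrite addrC lerD2l; exact: cap_ge0_coord.
split => //.
- exact: differentiable_bump.
- exact: continuous_grad_bump.
- apply: bounded_closed_compact; last exact: closed_closure.
  exists M; split; first exact: num_real.
  move=> y My x /subM/ball0_rVP xM.
  exact: ltW (lt_trans xM My).
Qed.

End bump.

(** * The decoupled subsolution *)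

Section subsolutions.
Context {R : realType} {n : nat}.
Implicit Types (a x : 'rV[R]_n) (f w : 'rV[R]_n -> R).

Lemma integrable_ball f (M : R) : 0 < M -> continuous f ->
  (@lebesgue_rV R n).-integrable (ball 0 M) (EFin \o f).
Proof.
move=> M0 cf; have [K fK] := continuous_bounded_ball M cf.
apply: measurable_bounded_integrable.
- exact: measurable_ball_rV.
- exact: lebesgue_rV_ball_lty.
- by apply: measurable_funTS; exact: continuous_measurable_rV.
- exists K; split; first exact: num_real.
  move=> y Ky x xM; apply: le_trans (ltW Ky); apply: fK.
  by move/ball0_rVP: xM => /ltW.
Qed.

Lemma Rintegral_sum d (T : measurableType d) (mu : {measure set T -> \bar R})
    (D : set T) (I : finType) (f : I -> T -> R) : measurable D ->
  (forall i, mu.-integrable D (EFin \o f i)) ->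
  \int[mu]_(x in D) (\sum_i f i x) = \sum_i \int[mu]_(x in D) f i x.
Proof.
move=> mD fi; rewrite /Rintegral sum_fine; last first.
  by move=> i _; apply: integrable_fin_num => //; exact: fi.
rewrite -(integral_sum mD fi); congr fine; apply: eq_integral => x _.
by rewrite sumEFin.
Qed.

(** Integrate by parts in each coordinate, moving the derivative from [w] to the
    C^1 function [bump_grad a i]. *)
Lemma bump_weak_laplacian a (M : R) w : 0 < M -> C01 (ball 0 M) w ->
  \int[lebesgue_rV n]_(x in ball 0 M) dot (grad (bump a) x) (grad w x) =
  \int[lebesgue_rV n]_(x in ball 0 M) - (\sum_i bump_hess a i x * w x).
Proof.
move=> M0 Cw; have [_ cgw _ _] := Cw.
have mO : measurable (ball (0 : 'rV[R]_n) M) by exact: measurable_ball_rV.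
have cbg i : continuous (bump_grad a i).
  by move=> x; exact/differentiable_continuous/differentiable_bump_grad.
have cDw i : continuous ('D_'e_i w) by exact: grad_continuous.
have cw := C01_continuous Cw.
have i1 i : (@lebesgue_rV R n).-integrable (ball 0 M)
    (EFin \o (fun x => bump_grad a i x * 'D_'e_i w x)).
  by apply: integrable_ball => // x; exact: (continuousM (cbg i x) (cDw i x)).
have i2 i : (@lebesgue_rV R n).-integrable (ball 0 M)
    (EFin \o (fun x => - (bump_hess a i x * w x))).
  apply: integrable_ball => // x.
  exact: (continuousN (continuousM (@continuous_bump_hess _ _ a i x) (cw x))).
have i3 i : (@lebesgue_rV R n).-integrable (ball 0 M)
    (EFin \o (fun x => bump_hess a i x * w x)).
  apply: integrable_ball => // x.
  exact: (continuousM (@continuous_bump_hess _ _ a i x) (cw x)).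
transitivity (\sum_i \int[lebesgue_rV n]_(x in ball 0 M)
    (bump_grad a i x * 'D_'e_i w x)).
  rewrite -(Rintegral_sum mO i1); apply: eq_Rintegral => x _.
  by apply: eq_bigr => i _; rewrite !gradE derive_bump.
transitivity (\sum_i \int[lebesgue_rV n]_(x in ball 0 M)
    (- (bump_hess a i x * w x))); last first.
  by rewrite -(Rintegral_sum mO i2); apply: eq_Rintegral => x _; rewrite sumrN.
apply: eq_bigr => i _; rewrite integration_by_parts_rV//; last 2 first.
  by move=> x; exact/diff_derivable/differentiable_bump_grad.
  rewrite (_ : 'D_'e_i (bump_grad a i) = bump_hess a i).
    exact: continuous_bump_hess.
  by apply/funext => x; rewrite derive_bump_grad.
under eq_Rintegral do rewrite derive_bump_grad.
under [RHS]eq_Rintegral do rewrite -mulN1r.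
by rewrite RintegralZl// mulN1r.
Qed.

Lemma bump_ge0 a x : 0 <= bump a x.
Proof. by rewrite /bump /pos_pow exprn_ge0// le_max lexx. Qed.

Lemma open_cap_gt0 a : open [set x | 0 < cap a x].
Proof.
rewrite (_ : [set x | _] = cap a @^-1` [set y | 0 < y])//.
by apply: open_comp; [move=> x _; exact: continuous_cap|exact: open_gt].
Qed.

Local Notation cube M := (ball (0 : 'rV[R]_n) M).

(** The bump is itself a test function, so its positive part lies in
    [W012] and its boundary supremum is at most [0]; but it is positive on a
    ball, which has positive measure. *)
Lemma bump_sup_gt_bdry a (M : R) (u : W12 (cube M)) :
  0 < M -> (forall i, `|a 0 i| + 1 < M) ->
  W12_fun u = bump a -> wgrad u = grad (bump a) ->
  ~ (ess_sup_on (cube M) u <= bdry_sup_pos (cube M) u)%E.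
Proof.
move=> M0 aM uE guE ub.
have b0 : (bdry_sup_pos (cube M) u <= 0)%E.
  apply: ereal_inf_lbound; exists 0 => //; split => //.
  exists u; split.
    by apply: aeW => x _; rewrite subr0 uE max_l// bump_ge0.
  move=> eps eps0; exists (bump a); first exact: bump_C01.
  rewrite integral0_eq ?lte_fin// => x _.
  by rewrite uE guE !subrr expr0n/= add0r /dot big1// => i _; rewrite mxE mul0r.
have /ess_supP[N [mN N0 subN]] := le_trans ub b0.
have [e e0 eN] : exists2 e : R, 0 < e & ball a e `<=` N.
  have oA : open ([set x | 0 < cap a x] `&` cube M).
    by apply: openI; [exact: open_cap_gt0|exact: ball_open].
  have Aa : ([set x | 0 < cap a x] `&` cube M) a.
    split => /=.
      by rewrite /cap subrr /dot big1 ?subr0// => i _; rewrite mxE mul0r.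
    apply/ball_rVP; split => // i; rewrite mxE sub0r normrN.
    by apply: lt_trans (aM i); rewrite ltrDl.
  have /nbhs_ballP[e /= e0 he] := open_nbhs_nbhs (conj oA Aa).
  exists e => // x /he[/= xa xM]; apply: subN => /=.
  rewrite /patch mem_set//= uE lee_fin /bump pos_pow_gt0//; apply/negP.
  by rewrite -ltNge exprn_gt0.
have : (lebesgue_rV n (ball a e) <= lebesgue_rV n N)%E.
  by apply: le_measure => //; rewrite inE//; exact: measurable_ball_rV.
rewrite N0 lebesgue_rV_ball// lee_fin; apply/negP.
by rewrite -ltNge exprn_gt0// mulr_gt0.
Qed.

Lemma signed_pow1 (s : R) : signed_pow 1 s = s.
Proof. by rewrite /signed_pow subrr powRr0 mul1r. Qed.

(** The bump against a constant: [v] is tuned so that [lambda * v] equals the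
    bound [K] of the Laplacian, which absorbs the sign of [lambda]. *)
Lemma bump_const_subsolution a (M lambda mu : R) (tau : 'rV[R]_n -> R) :
  0 < M -> (forall i, `|a 0 i| + 1 < M) ->
  (forall x, 0 < cap a x -> tau x = 0) -> lambda != 0 ->
  exists u v : W12 (cube M),
    [/\ weak_le u (fun x =>
          lambda * \1_[set y | 0 < cap a y] x * signed_pow 1 (v x)),
        weak_le v (fun x => mu * tau x * signed_pow 1 (u x)) &
        ~ (ess_sup_on (cube M) u <= bdry_sup_pos (cube M) u)%E].
Proof.
move=> M0 aM tau0 l0.
have mO : measurable (cube M) by exact: measurable_ball_rV.
pose L x := \sum_i bump_hess a i x.
have cL : continuous L.
  rewrite (_ : L = \sum_i bump_hess a i); last first.
    by apply/funext => x; rewrite fct_sumE.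
  elim/big_ind: _ => [|f g cf cg x|i _]; first exact: cst_continuous.
    exact: (continuousD (cf x) (cg x)).
  exact: continuous_bump_hess.
have [K LK] := continuous_bounded_ball M cL.
have [u [uE guE]] :=
  C1_W12 M0 (@differentiable_bump _ _ a) (@continuous_grad_bump _ _ a).
have grad0 (c : R) : grad (cst c : 'rV[R]_n -> R) = cst 0.
  by apply/funext => x; apply/rowP => i; rewrite gradE derive_cst mxE.
have [||v [vE gvE]] := @C1_W12 _ _ (cst (K / lambda) : 'rV[R]_n -> R) _ M0.
- by move=> x; exact: differentiable_cst.
- by rewrite grad0; exact: cst_continuous.
exists u, v; split; last exact: (bump_sup_gt_bdry M0 aM uE guE).
- move=> w Cw w0; have cw := C01_continuous Cw.
  set A := [set y | 0 < cap a y].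
  have hE x : lambda * \1_A x * signed_pow 1 (v x) = K * \1_A x.
    by rewrite signed_pow1 vE /=; field.
  under eq_fun do rewrite hE.
  have ci : (@lebesgue_rV R n).-integrable (cube M)
      (fun x => (K * \1_A x * w x)%:E).
    have [Kw wK] := continuous_bounded_ball M cw.
    apply: measurable_bounded_integrable => //.
    + exact: lebesgue_rV_ball_lty.
    + apply: measurable_funTS; apply: measurable_funM.
        apply: measurable_funM => //; apply: measurable_indic.
        by apply: open_measurable_rV; exact: open_cap_gt0.
      exact: continuous_measurable_rV.
    + exists (`|K| * Kw); split; first exact: num_real.
      move=> y Ky x xM /=; apply: le_trans (ltW Ky).
      have xM' : `|x| <= M.
        by move/ball0_rVP: xM => /ltW.
      rewrite normrM ler_pM//; last exact: wK.
      rewrite normrM ler_piMr// indicE.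
      by case: (x \in A); rewrite ?normr1 ?normr0.
  split=> //; under [leRHS]eq_Rintegral do rewrite hE.
  rewrite guE bump_weak_laplacian//; apply: le_Rintegral => //.
    have -> : (EFin \o (fun x => - (\sum_i bump_hess a i x * w x))) =
        EFin \o (fun x => - (L x * w x)).
      by apply/funext => x /=; rewrite /L mulr_suml.
    apply: integrable_ball => // x.
    exact: (continuousN (continuousM (cL x) (cw x))).
  move=> x xM; rewrite -mulr_suml -/(L x) -mulNr ler_wpM2r//.
  (* [- Delta u <= K] on [A], and [Delta u] vanishes off [A] *)
  rewrite indicE; case: (boolP (x \in A)) => [_|].
    rewrite mulr1 (le_trans (ler_norm _))// normrN; apply: LK.
    by move/ball0_rVP: xM => /ltW.
  rewrite notin_setE /A/= => /negP; rewrite -leNgt => xA.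
  by rewrite mulr0 /L big1 ?oppr0// => i _; exact: bump_hess_outside.
- move=> w Cw w0.
  have hE x : mu * tau x * signed_pow 1 (u x) * w x = 0.
    rewrite signed_pow1 uE; have [xA|xA] := ltP 0 (cap a x).
      by rewrite tau0// mulr0 !mul0r.
    by rewrite /bump pos_pow_le0// mulr0 mul0r.
  under eq_fun do rewrite hE.
  under [leRHS]eq_Rintegral do rewrite hE.
  split; first exact: integrable0.
  rewrite (@eq_Rintegral _ _ _ _ _ (fun=> 0))// => x _.
  by rewrite gvE grad0 /dot big1// => i _; rewrite mxE mul0r.
Qed.

End subsolutions.

(** * The counterexample *)

Theorem mainTheorem3 (R : realType) (n : nat) (n_ge2 : (2 <= n)%N) :
  exists (Omega : set 'rV[R]_n) (rho tau : 'rV[R]_n -> R) (alpha beta : R),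
    [/\ open Omega,
        exists2 q : R, n%:R < q & Lp Omega (q / 2) rho /\ Lp Omega (q / 2) tau,
        0 < alpha /\ 0 < beta,
        alpha * beta = 1 &
        forall lambda mu : R, (lambda, mu) <> (0, 0) ->
          exists u v : W12 Omega,
            weak_subsolution lambda mu alpha beta rho tau u v /\
            (~ (ess_sup_on Omega u <= bdry_sup_pos Omega u)%E \/
             ~ (ess_sup_on Omega v <= bdry_sup_pos Omega v)%E)].
Proof.
have i0 : 'I_n by exists 0%N; exact: leq_trans n_ge2.
pose a : 'rV[R]_n := 0.
pose b : 'rV[R]_n := const_mx 3.
pose ind c : 'rV[R]_n -> R := \1_[set x | 0 < cap c x].
have M0 : 0 < 5 :> R by [].
have aM i : `|a 0 i| + 1 < 5 by rewrite mxE normr0; lra.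
have bM i : `|b 0 i| + 1 < 5 by rewrite mxE ger0_norm//; lra.
(* a common point would have first coordinate both at most 1 and at least 2 *)
have ab x : 0 < cap a x -> 0 < cap b x -> False.
  move=> /ltW xa /ltW xb.
  have := cap_ge0_coord i0 xa; have := cap_ge0_coord i0 xb.
  by rewrite !mxE !ler_norml; lra.
have Lind p c : 1 <= p -> Lp (ball (0 : 'rV[R]_n) 5) p (ind c).
  move=> p1; apply: (Lp_bounded (K := 1)) => //.
  - exact: measurable_ball_rV.
  - exact: lebesgue_rV_ball_lty.
  - by apply: measurable_indic; apply: open_measurable_rV; exact: open_cap_gt0.
  - move=> x _; rewrite /ind indicE.
    by case: (_ \in _); rewrite ?normr1 ?normr0.
exists (ball 0 5), (ind a), (ind b), 1, 1; split.
- exact: ball_open.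
- exists (n%:R + 1); first by rewrite ltrDl.
  suff p1 : 1 <= (n%:R + 1) / 2 :> R by split; exact: Lind.
  have : 2 <= n%:R :> R by rewrite ler_nat.
  lra.
- by [].
- by rewrite mulr1.
- move=> lambda mu lm.
  have [l0|l0] := eqVneq lambda 0.
    have m0 : mu != 0 by apply: contra_notN lm => /eqP ->; rewrite l0.
    have ba x : 0 < cap b x -> ind a x = 0.
      by move=> xb; rewrite /ind indicE memNset// => xa; exact: (ab x).
    have [u [v [su sv nu]]] := bump_const_subsolution lambda M0 bM ba m0.
    by exists v, u; split; [split|right].
  have ba x : 0 < cap a x -> ind b x = 0.
    by move=> xa; rewrite /ind indicE memNset// => xb; exact: (ab x).
  have [u [v [su sv nu]]] := bump_const_subsolution mu M0 aM ba l0.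
  by exists u, v; split; [split|left].
Qed.
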